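(* Let $G$ be a finite non-solvable group and $x$ an element of $G$. Then $N_G(\langle x\rangle)\subseteq Sol_G(x)$. In particular, if $x,y\in G\setminus Sol(G)$ are two elements such that $y\in N_G(\langle x\rangle)$, then $y$ is not adjacent to $x$ in $\widehat{\mathcal{S}_G}$.
   Context: For a finite group $G$ and $x\in G$, the solvabilizer of $x$ is $Sol_G(x)=\{y\in G : \langle x,y\rangle \text{ is solvable}\}$, and $Sol(G)=\{x\in G : \langle x,y\rangle \text{ is solvable for all } y\in G\}$ (it is known that $Sol(G)$ equals the solvable radical of $G$). $N_G(\langle x\rangle)$ is the normalizer of $\langle x\rangle$ in $G$. The non-solvable graph $\mathcal{S}_G$ is the simple graph with vertex set $G$ in which two distinct elements $x,y$ are adjacent if and only if $\langle x,y\rangle$ is not solvable. $\widehat{\mathcal{S}_G}$ is the induced subgraph of $\mathcal{S}_G$ on $G\setminus Sol(G)$. *)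

(* Defs.v *)
From mathcomp Require Import all_boot all_fingroup all_solvable.

Set Implicit Arguments.
Unset Strict Implicit.
Unset Printing Implicit Defensive.

Import GroupScope.

(* The vertex set of a simple graph is a subset of an ambient finite type, so
   that passing to an induced subgraph does not change the type of vertices. *)
Record sgraph (T : finType) := SGraph {
  vertices : {set T};
  adj : rel T;
  adj_sym : symmetric adj;
  adj_irrefl : irreflexive adj;
  adj_vertices : forall u v, adj u v -> (u \in vertices) && (v \in vertices)
}.

Section Induced.
Variables (T : finType) (S : sgraph T) (A : {set T}).

Definition induced_rel : rel T :=
  [rel u v | [&& u \in A, v \in A & adj S u v]].

Fact induced_rel_sym : symmetric induced_rel.
Proof. by move=> u v; rewrite /induced_rel /= adj_sym andbCA. Qed.

Fact induced_rel_irrefl : irreflexive induced_rel.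
Proof. by move=> u; rewrite /induced_rel /= adj_irrefl !andbF. Qed.

Fact induced_rel_vertices u v :
  induced_rel u v -> (u \in vertices S :&: A) && (v \in vertices S :&: A).
Proof.
by case/and3P=> Au Av /adj_vertices/andP[Su Sv]; rewrite !inE Su Sv Au Av.
Qed.

Definition induced_subgraph : sgraph T :=
  SGraph induced_rel_sym induced_rel_irrefl induced_rel_vertices.

End Induced.

Section NonSolvableGraph.
Variables (gT : finGroupType) (G : {group gT}).

Definition solvabilizer (x : gT) : {set gT} :=
  [set y in G | solvable <<[set x; y]>>].

Definition Sol : {set gT} :=
  [set x in G | [forall y in G, solvable <<[set x; y]>>]].

Definition nonsolvable_rel : rel gT :=
  [rel x y | [&& x \in G, y \in G, x != y & ~~ solvable <<[set x; y]>>]].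

Fact nonsolvable_rel_sym : symmetric nonsolvable_rel.
Proof. by move=> x y; rewrite /nonsolvable_rel /= andbCA eq_sym setUC. Qed.

Fact nonsolvable_rel_irrefl : irreflexive nonsolvable_rel.
Proof. by move=> x; rewrite /nonsolvable_rel /= eqxx !andbF. Qed.

Fact nonsolvable_rel_vertices x y :
  nonsolvable_rel x y -> (x \in (G : {set gT})) && (y \in (G : {set gT})).
Proof. by case/and4P=> -> ->. Qed.

Definition nonsolvable_graph : sgraph gT :=
  SGraph nonsolvable_rel_sym nonsolvable_rel_irrefl nonsolvable_rel_vertices.

Definition nonsolvable_graph_hat : sgraph gT :=
  induced_subgraph nonsolvable_graph (G :\: Sol).

End NonSolvableGraph.

(* Main.v *)
Require Import Defs.
From mathcomp Require Import all_boot all_fingroup all_solvable.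
Import GroupScope.

(** If [y] normalizes [<[x]>], then [<[x]>] is normal in the group generated by [x] and [y], with
    quotient an image of [<[y]>]. That group is thus cyclic-by-cyclic, hence solvable, which rules
    out an edge. *)

(** Solvability is closed under extensions, and the join modulo [H] is the image of [K]. *)
Lemma solvable_joing (gT : finGroupType) (H K : {group gT}) :
  K \subset 'N(H) -> solvable H -> solvable K -> solvable (H <*> K).
Proof.
move=> nHK solH solK.
have nsH : H <| H <*> K by rewrite normalYl.
by rewrite (series_sol nsH) solH quotientYidl // quotient_sol.
Qed.

Lemma solvable_gen_norm_cycle (gT : finGroupType) (x y : gT) :
  y \in 'N(<[x]>) -> solvable <<[set x; y]>>.
Proof.
move=> nxy.
have ->: <<[set x; y]>> = <[x]> <*> <[y]> by rewrite joing_idl joing_idr.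
by apply: solvable_joing; rewrite ?cycle_subG // abelian_sol ?cycle_abelian.
Qed.

Theorem theorem4p1 (gT : finGroupType) (G : {group gT}) (nsolG : ~~ solvable G) :
  (forall x : gT, x \in G -> 'N_G(<[x]>) \subset solvabilizer G x) /\
  (forall x y : gT, x \in G :\: Sol G -> y \in G :\: Sol G ->
     y \in 'N_G(<[x]>) -> ~~ adj (nonsolvable_graph_hat G) y x).
Proof.
split=> [x _ | x y _ _].
  apply/subsetP=> y /setIP[Gy nxy].
  by rewrite inE Gy solvable_gen_norm_cycle.
(* Symmetry puts [x] first, so that the generating set is [[set x; y]], as in
   [solvable_gen_norm_cycle]. *)
case/setIP=> _ nxy; rewrite adj_sym.
by rewrite /= /induced_rel /= /nonsolvable_rel /= solvable_gen_norm_cycle // !andbF.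
Qed.
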